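(* For all positive integers $m$ and $d$, $\beta_{\{2,4,\ldots,2m\}}(d) = \beta_{\{1,2,\ldots,2m\}}(d) + 1$.
   Context: For a set $W$ of positive integers containing at least one even number, $\beta_W(d)$ denotes the largest size of a set $A \subseteq \mathbb{Z}_2^d$ (of distinct elements) which has no subset $B \subseteq A$ with $|B| \in W$ and $\sum_{x\in B} x = 0$. *)

(* Defs.v *)
From mathcomp Require Import all_boot all_order all_algebra.

Set Implicit Arguments.
Unset Strict Implicit.
Unset Printing Implicit Defensive.

Import GRing.Theory.

Definition zero_sum_free (W : pred nat) (d : nat) (A : {set 'rV['Z_2]_d}) : bool :=
  [forall B : {set 'rV['Z_2]_d},
     (B \subset A) && W #|B| ==> ((\sum_(x in B) x)%R != 0%R)].

(* W is meant to consist of positive integers, so that set0 is always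
   zero-sum free and the maximum ranges over a nonempty family. *)
Definition beta (W : pred nat) (d : nat) : nat :=
  \max_(A : {set 'rV['Z_2]_d} | zero_sum_free W A) #|A|.

(* Main.v *)
Require Import Defs.
From mathcomp Require Import all_boot all_order all_algebra.

(* Adjoining 0 to a set without short zero sums creates no even short zero sum.
   Conversely, if A has no even short zero sum, translate A by some a in A and
   drop the resulting 0: a zero sum of k translates says that k elements of
   A \ {a} sum to k a, so these elements, together with a when k is odd, form
   an even zero sum in A. *)

Import GRing.Theory.

Lemma addrr_Z2 (d : nat) (v : 'rV['Z_2]_d) : (v + v = 0)%R.
Proof.
rewrite -mulr2n -scaler_nat (_ : 2%:R = 0 :> 'Z_2)%R ?scale0r //.
exact/val_inj.
Qed.

Lemma mulrn_Z2 (d k : nat) (v : 'rV['Z_2]_d) : (v *+ k = v *+ odd k)%R.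
Proof.
rewrite -{1}(odd_double_half k) mulrnDr -muln2 mulnC mulrnA mulr2n.
by rewrite addrr_Z2 mul0rn addr0.
Qed.

Lemma beta_even_ge (m d : nat) : 0 < m ->
  beta [pred k | 0 < k <= 2 * m] d + 1 <=
  beta [pred k | (0 < k <= 2 * m) && ~~ odd k] d.
Proof.
move=> m0; rewrite {1}/beta.
have [|A /forallP Afree ->] := @eq_bigmax_cond _
    [pred A : {set 'rV['Z_2]_d} | zero_sum_free [pred k | 0 < k <= 2 * m] A]
    (fun A => #|A|).
  (* The witness [set0] makes the family nonempty, so the maximum is attained by some [A]. *)
  apply/card_gt0P; exists set0; apply/forallP => B; apply/implyP => /andP[].
  by rewrite subset0 => /eqP ->; rewrite /= cards0.
(* Since [0 < m], size 1 is admissible, so [[set 0]] would itself be a forbidden zero sum. *)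
have A0 : 0%R \notin A.
  apply/negP => A0; have := Afree [set 0%R].
  by rewrite sub1set A0 /= cards1 big_set1 eqxx muln_gt0 m0.
have <- : #|0%R |: A| = #|A| + 1 by rewrite cardsU1 A0 addnC.
apply: leq_bigmax_cond; apply/forallP => B.
apply/implyP => /andP[sBA /= /andP[/andP[k0 km] kodd]].
have := Afree (B :\ 0%R); rewrite /= subDset sBA /=.
have -> : (\sum_(x in B :\ 0%R) x = \sum_(x in B) x)%R.
  have [B0|B0] := boolP (0%R \in B); first by rewrite (big_setD1 _ B0) /= add0r.
  apply: eq_bigl => x; rewrite in_setD1.
  by case: eqVneq => // ->; rewrite (negPf B0).
move/implyP; apply.
rewrite (leq_trans (subset_leq_card (subsetDl _ _)) km) andbT.
(* A nonempty set of even size has at least two elements, so removing 0 cannot empty it. *)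
by move: k0 kodd; rewrite (cardsD1 0%R B); case: (_ \in _); case: #|_|.
Qed.

Lemma beta_even_le (m d : nat) :
  beta [pred k | (0 < k <= 2 * m) && ~~ odd k] d <=
  beta [pred k | 0 < k <= 2 * m] d + 1.
Proof.
apply/bigmax_leqP => A /forallP Afree.
have [->|[a aA]] := set_0Vmem A; first by rewrite cards0.
have addaI : injective (fun x : 'rV['Z_2]_d => x + a)%R by apply: addIr.
rewrite (cardsD1 a) aA addnC leq_add2r -(card_imset _ addaI).
apply: leq_bigmax_cond; apply/forallP => B.
apply/implyP => /andP[sBA /= /andP[k0 km]]; apply/eqP => sumB0.
have addaK (x : 'rV['Z_2]_d) : (x + a + a = x)%R by rewrite -addrA addrr_Z2 addr0.
(* Translation by [a] is an involution in characteristic 2, so it carries [B] back into [A :\ a]. *)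
pose C := [set x + a | x in B]%R.
have sCA : C \subset A :\ a.
  by apply/subsetP => _ /imsetP[x /(subsetP sBA)/imsetP[y yA ->] ->]; rewrite addaK.
have cardC : #|C| = #|B| by rewrite card_imset.
have sumC : (\sum_(x in C) x = a *+ odd #|B|)%R.
  rewrite big_imset ?big_split /= => [|x y _ _ /addaI//].
  by rewrite sumB0 add0r sumr_const mulrn_Z2.
have aC : a \notin C by apply/negP => /(subsetP sCA); rewrite !inE eqxx.
have sCA' : C \subset A := subset_trans sCA (subsetDl _ _).
case Bodd: (odd #|B|) in sumC.
  (* Adjoining [a] cancels the sum [a] of [C] and makes the size even. *)
  have := Afree (a |: C).
  rewrite /= subUset sub1set aA sCA' cardsU1 aC cardC big_setU1 //=.
  rewrite sumC mulr1n addrr_Z2 eqxx Bodd /= andbT implybF.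
  (* An odd size at most [2 * m] is strictly smaller, which leaves room for [a]. *)
  rewrite ltn_neqAle km andbT negbK => /eqP km2.
  by move: Bodd; rewrite km2 mul2n odd_double.
by have := Afree C; rewrite /= sCA' cardC k0 km Bodd sumC eqxx.
Qed.

Theorem theorem3 (m d : nat) (hm : 0 < m) (hd : 0 < d) :
  beta [pred k | (0 < k <= 2 * m) && ~~ odd k] d =
  beta [pred k | 0 < k <= 2 * m] d + 1.
Proof. by apply/eqP; rewrite eqn_leq beta_even_le beta_even_ge. Qed.
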